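(* Let $(X,d)$ be a compact metric space and let $T_1,\dots,T_k\colon X\to X$ ($k\ge2$) be continuous maps such that the set $S_{\mathrm t}$ of weakly hyperbolic sequences of $\mathrm{IFS}(T_1,\dots,T_k)$ is non-empty. Then $$\lim_{n\to\infty}\mathcal B^n(K)=\overline{A_{\mathrm t}}\quad\text{for every non-empty compact set }K\subset\overline{A_{\mathrm t}},$$ where $\mathcal B$ is the Barnsley-Hutchinson operator, $A_{\mathrm t}$ is the target set, and the limit is in the Hausdorff distance.
   Context: The Barnsley-Hutchinson operator of $\mathrm{IFS}(T_1,\dots,T_k)$ is $\mathcal B(A)=\bigcup_{i=1}^k T_i(A)$ for $A\subset X$. $\Sigma_k^+=\{1,\dots,k\}^{\mathbb N}$. The set of weakly hyperbolic sequences is $S_{\mathrm t}=\{\xi\in\Sigma_k^+ : \lim_{n\to\infty}\mathrm{diam}(T_{\xi_0}\circ\cdots\circ T_{\xi_n}(X))=0\}$. The coding map $\pi\colon S_{\mathrm t}\to X$ is $\pi(\xi)=\lim_{n\to\infty}T_{\xi_0}\circ\cdots\circ T_{\xi_n}(p)$, which does not depend on $p\in X$. The target set is $A_{\mathrm t}=\pi(S_{\mathrm t})$. *)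

(* Defs.v *)
From mathcomp Require Import all_boot all_order all_algebra.
From mathcomp Require Import all_classical all_reals.
From mathcomp Require Import topology normedtype.

Set Implicit Arguments.
Unset Strict Implicit.
Unset Printing Implicit Defensive.

Import Order.TTheory GRing.Theory Num.Theory.
Import numFieldNormedType.Exports.

Local Open Scope classical_set_scope.
Local Open Scope ring_scope.

(* [sup] and [inf] are real-valued and return 0 on sets that are empty or
   unbounded.  In a compact space every set of distances is bounded, so this
   convention only concerns empty sets. *)

Definition diam (R : realType) (X : metricType R) (A : set X) : R :=
  sup [set mdist x y | x in A & y in A].

Definition set_dist (R : realType) (X : metricType R) (A : set X) (x : X) : R :=
  inf [set mdist x y | y in A].

Definition hausdorff_dist (R : realType) (X : metricType R) (A B : set X) : R :=
  Num.max (sup [set set_dist B x | x in A]) (sup [set set_dist A y | y in B]).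

Definition barnsley_hutchinson (X : Type) (k : nat) (T : 'I_k -> X -> X)
    (A : set X) : set X :=
  \bigcup_(i in [set: 'I_k]) (T i @` A).

(* T (xi 0) \o T (xi 1) \o ... \o T (xi n): the last map is applied first. *)
Fixpoint backward_comp (X : Type) (k : nat) (T : 'I_k -> X -> X)
    (xi : nat -> 'I_k) (n : nat) : X -> X :=
  if n is m.+1 then backward_comp T xi m \o T (xi n) else T (xi 0).

Definition weakly_hyperbolic (R : realType) (X : metricType R) (k : nat)
    (T : 'I_k -> X -> X) : set (nat -> 'I_k) :=
  [set xi | diam (range (backward_comp T xi n)) @[n --> \oo] --> (0 : R)].

(* The limit of T (xi 0) \o ... \o T (xi n) at the base point p; p also serves
   as the default value when there is no limit.  [coding_mapP] below shows that,
   on weakly hyperbolic sequences, the limit exists and does not depend on p. *)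
Definition coding_map (R : realType) (X : metricType R) (k : nat)
    (T : 'I_k -> X -> X) (p : X) (xi : nat -> 'I_k) : X :=
  xget p [set x | backward_comp T xi n p @[n --> \oo] --> x].

Definition target_set (R : realType) (X : metricType R) (k : nat)
    (T : 'I_k -> X -> X) (p : X) : set X :=
  coding_map T p @` weakly_hyperbolic T.

Lemma mdist_ubound (R : realType) (X : metricType R) (p : X) :
  compact [set: X] -> exists M : R, forall x y : X, mdist x y <= M.
Proof.
move=> cX; have cd : continuous (mdist p : X -> R).
  move=> x; apply/cvgrPdist_lt => e e0.
  apply/metricType_numDomainType.nbhs_mdistP; exists e => //= y xy.
  apply: le_lt_trans xy; rewrite ler_distlC.
  have := metric_triangle p x y; have := metric_triangle p y x.
  by rewrite (metric_sym y x) lerBlDr => -> ->.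
have : compact (mdist p @` [set: X]).
  by apply: continuous_compact => //; exact: continuous_subspaceT.
move/compact_bounded => [M [_ /(_ (M + 1))]].
rewrite ltrDl ltr01 => /(_ isT) HM; exists (M + 1 + (M + 1)) => x y.
apply: le_trans (metric_triangle x p y) _; rewrite (metric_sym x p).
by apply: lerD; apply: le_trans (ler_norm _) (HM _ _) => //=; [exists x|exists y].
Qed.

Lemma mdist_le_diam (R : realType) (X : metricType R) (A : set X) (x y : X) :
  compact [set: X] -> A x -> A y -> mdist x y <= diam A.
Proof.
move=> /(mdist_ubound x)[M HM] Ax Ay; apply: ub_le_sup.
  by exists M => _ [u _ [v _ <-]].
by exists x => //; exists y.
Qed.

Lemma range_backward_comp (X : Type) (k : nat) (T : 'I_k -> X -> X)
    (xi : nat -> 'I_k) (m n : nat) : (m <= n)%N ->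
  range (backward_comp T xi n) `<=` range (backward_comp T xi m).
Proof.
elim: n => [|n IH]; first by rewrite leqn0 => /eqP ->.
rewrite leq_eqVlt => /predU1P[-> //|/IH mn]; apply: subset_trans mn.
by move=> _ [x _ <-]; exists (T (xi n.+1) x).
Qed.

Lemma coding_mapP (R : realType) (X : metricType R) (k : nat)
    (T : 'I_k -> X -> X) (p : X) (xi : nat -> 'I_k) (q : X) :
  compact [set: X] -> weakly_hyperbolic T xi ->
  backward_comp T xi n q @[n --> \oo] --> coding_map T p xi.
Proof.
move=> cX St; have [x cx] : exists x : X,
    forall q, backward_comp T xi n q @[n --> \oo] --> x.
  have [x [_ clx]] :=
    [elaborate cX (backward_comp T xi n p @[n --> \oo]) _ filterT].
  exists x => r; apply/metricType_numDomainType.cvgrPdist_lt => e e0.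
  have e20 : 0 < e / 2 by rewrite divr_gt0.
  move/cvgr0Pnorm_lt : St => /(_ _ e20)[N _ HN].
  pose tail := [set backward_comp T xi m p | m in [set m | (N <= m)%N]].
  have [|_ [[m /= Nm <-] xm]] := clx tail (ball x (e / 2)) _ (nbhsx_ballx _ _ e20).
    by exists N => // m Nm; exists m.
  rewrite ballEmdist /= in xm.
  exists m => // n /= mn; apply: le_lt_trans (metric_triangle _ (backward_comp T xi m p) _) _.
  rewrite [e]splitr; apply: ltrD xm _; apply: le_lt_trans (HN m Nm).
  apply: le_trans (ler_norm _); apply: mdist_le_diam => //.
  by apply: range_backward_comp mn _ _; exists r.
suff -> : coding_map T p xi = x by exact: cx.
rewrite /coding_map; case: xgetP => [y _ /= cy|/(_ x)[]]; last exact: cx.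
exact: (cvg_unique (@metric_hausdorff _ _)) cy (cx p).
Qed.

(* Main.v *)
Require Import Defs.
From mathcomp Require Import all_boot all_order all_algebra.
From mathcomp Require Import all_classical all_reals topology normedtype.
From mathcomp Require Import ring.

Import Order.TTheory GRing.Theory Num.Theory.
Import numFieldNormedType.Exports.

Local Open Scope classical_set_scope.
Local Open Scope ring_scope.

(** Two facts about the orbit of [K] under the operator give the limit.

    The orbit never leaves the closure [C] of the target set.  Putting a symbol
    [i] in front of a weakly hyperbolic sequence with limit [a] gives a weakly
    hyperbolic sequence with limit [T i a] ([target_set_invariant]): the ranges
    of the compositions shrink to [a], so continuity of [T i] at [a] makes
    their images shrink to [T i a].  Hence [T i] maps the target set into
    itself, and, being continuous, it maps [C] into itself.  This makes the
    first half of the Hausdorff distance vanish.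

    Conversely the orbit approaches every point of the target set.  For [q] in
    [K], the [n.+1]-st iterate contains [backward_comp T xi n q], a term of
    the sequence that converges to the image of [xi] under the coding map.  So
    each point of the target set is a limit of points of the iterates
    ([target_set_iter_near]).  Points near it are then served
    by the same points of the iterates, and compactness of [C] makes the rank
    from which this holds uniform on [C] ([compact_eventually_close]). *)

Section Hausdorff.
Context {R : realType} {X : metricType R}.
Implicit Types (A B : set X) (x y : X) (e : R).

Lemma set_dist_ge0 A x : 0 <= set_dist A x.
Proof.
rewrite /set_dist; have [->|A0] := eqVneq A set0.
  by rewrite image_set0 inf0.
apply: lb_le_inf; last by move=> _ [y _ <-]; exact: mdist_ge0.
by have /set0P[y Ay] := A0; exists (mdist x y), y.
Qed.

Lemma set_dist_le A x y e : A y -> mdist x y <= e -> set_dist A x <= e.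
Proof.
move=> Ay; apply: le_trans; apply: ge_inf; last by exists y.
by exists 0 => _ [z _ <-]; exact: mdist_ge0.
Qed.

(** Holds for empty or unbounded sets as well, where [sup] takes the default value 0. *)
Lemma sup_ge0 (S : set R) : (forall r, S r -> 0 <= r) -> 0 <= sup S.
Proof.
move=> S_ge0; have [supS|/sup_out -> //] := pselect (has_sup S).
have [[r Sr] ubS] := supS; apply: le_trans (S_ge0 r Sr) _.
exact: ub_le_sup.
Qed.

Lemma hausdorff_dist_ge0 A B : 0 <= hausdorff_dist A B.
Proof.
rewrite /hausdorff_dist le_max; apply/orP; left.
by apply: sup_ge0 => _ [x _ <-]; exact: set_dist_ge0.
Qed.

Lemma sup_set_dist_le A B e : 0 <= e ->
    (forall x, B x -> exists2 y, A y & mdist x y <= e) ->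
  sup [set set_dist A x | x in B] <= e.
Proof.
move=> e0 AB; have [->|B0] := eqVneq B set0; first by rewrite image_set0 sup0.
apply: ge_sup => [|_ [x /AB[y Ay xy] <-]]; last exact: set_dist_le xy.
by have /set0P[x Bx] := B0; exists (set_dist A x), x.
Qed.

Lemma hausdorff_dist_sub_le A B e : 0 <= e -> A `<=` B ->
    (forall y, B y -> exists2 x, A x & mdist y x <= e) ->
  hausdorff_dist A B <= e.
Proof.
move=> e0 AB BA; rewrite /hausdorff_dist ge_max; apply/andP.
split; apply: sup_set_dist_le => // x Ax.
by exists x; [exact: AB|rewrite mdistxx].
Qed.

(** A point of [F n] that is close to some [a] in [A] is also close to
    everything near [a].  So pointwise approximation on the dense subset [A]
    gives a locally constant rank on the closure, and compactness a constant
    one. *)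
Lemma compact_eventually_close A (F : nat -> set X) e :
    compact (closure A) -> 0 < e ->
    (forall a, A a -> forall d, 0 < d ->
      \forall n \near \oo, exists2 z, F n z & mdist a z < d) ->
  \forall n \near \oo,
    forall x, closure A x -> exists2 z, F n z & mdist x z < e.
Proof.
move=> /compact_near_coveringP cA e0 AF.
have e30 : 0 < e / 3%:R by rewrite divr_gt0.
apply: (cA _ _ (fun n x => exists2 z, F n z & mdist x z < e)) => x Ax.
have [a [Aa]] := Ax _ (nbhsx_ballx x _ e30); rewrite ballEmdist /= => xa.
exists (ball x (e / 3%:R),
    [set n | exists2 z, F n z & mdist a z < e / 3%:R]); first split.
- exact: nbhsx_ballx.
- exact: AF.
move=> [x' n] [/=]; rewrite ballEmdist /= => xx' [z Fz az].
exists z => //; apply: le_lt_trans (metric_triangle x' x z) _.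
have -> : e = e / 3%:R + (e / 3%:R + e / 3%:R) by field.
rewrite metric_sym; apply: ltrD xx' _.
by apply: le_lt_trans (metric_triangle x a z) _; exact: ltrD.
Qed.

End Hausdorff.

Section Orbits.
Context {R : realType} {X : metricType R} {k : nat}.
Context (T : 'I_k -> X -> X) (p : X) (cX : compact [set: X]).
Implicit Types (xi : nat -> 'I_k) (a : X) (A : set X).

Lemma range_backward_comp_near xi d : weakly_hyperbolic T xi -> 0 < d ->
  \forall n \near \oo,
    range (backward_comp T xi n) `<=` ball (coding_map T p xi) d.
Proof.
move=> St d0; have d20 : 0 < d / 2%:R by rewrite divr_gt0.
move/cvgr0Pnorm_lt : (St) => /(_ _ d20)[N _ HN].
have := @coding_mapP R X k T p xi p cX St => /metricType_numDomainType.cvgrPdist_lt.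
move=> /(_ _ d20)[M _ HM].
exists N => // n /= Nn _ [x _ <-]; rewrite ballEmdist /=.
pose m := maxn n M.
apply: le_lt_trans (metric_triangle _ (backward_comp T xi m p) _) _.
rewrite [d]splitr; apply: ltrD; first by apply: HM; rewrite /= leq_maxr.
apply: le_lt_trans (HN n Nn); apply: le_trans (ler_norm _).
apply: mdist_le_diam => //.
by apply: (@range_backward_comp _ _ T xi n m); [exact: leq_maxl|exists p].
Qed.

(** Converse of [range_backward_comp_near]: shrinking to a point means
    that diameters tend to 0, and identifies the limit. *)
Lemma weakly_hyperbolic_near xi a :
    (forall d, 0 < d -> \forall n \near \oo,
       range (backward_comp T xi n) `<=` ball a d) ->
  weakly_hyperbolic T xi /\ coding_map T p xi = a.
Proof.
move=> xia; have St : weakly_hyperbolic T xi.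
  apply/cvgr0Pnorm_le => e e0; have e20 : 0 < e / 2%:R by rewrite divr_gt0.
  apply: filterS (xia _ e20) => n sub.
  have rangeP x : mdist a (backward_comp T xi n x) < e / 2%:R.
    by have := sub _ (imageP _ (I : setT x)); rewrite ballEmdist.
  rewrite ger0_norm; last first.
    by apply: sup_ge0 => _ [x _ [y _ <-]]; exact: mdist_ge0.
  apply: ge_sup => [|_ [_ [x _ <-] [_ [y _ <-] <-]]].
    exists (mdist (backward_comp T xi n p) (backward_comp T xi n p)).
    by exists (backward_comp T xi n p) => //; exists (backward_comp T xi n p).
  apply: le_trans (metric_triangle _ a _) _.
  by rewrite [e]splitr metric_sym; apply: lerD; exact: ltW.
split=> //; have cp := @coding_mapP R X k T p xi p cX St.
apply: (cvg_unique (@metric_hausdorff _ _)) cp _.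
apply/metricType_numDomainType.cvgrPdist_lt => e e0.
apply: filterS (xia e e0) => n sub.
by have := sub _ (imageP _ (I : setT p)); rewrite ballEmdist.
Qed.

Definition seq_cons (i : 'I_k) xi : nat -> 'I_k :=
  fun n => if n is m.+1 then xi m else i.

Lemma backward_comp_cons i xi n :
  backward_comp T (seq_cons i xi) n.+1 = T i \o backward_comp T xi n.
Proof.
elim: n => // n IH.
by rewrite -[LHS]/(backward_comp T (seq_cons i xi) n.+1 \o T (xi n.+1)) IH.
Qed.

Lemma target_set_invariant i a : continuous (T i) ->
  target_set T p a -> target_set T p (T i a).
Proof.
move=> cT [xi St <-]; set a' := coding_map T p xi.
have [|St' eq] := weakly_hyperbolic_near (seq_cons i xi) (T i a'); last first.
  by exists (seq_cons i xi).
move=> d d0; have := cT a' _ (nbhsx_ballx _ _ d0).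
rewrite /= -nbhs_ballE => -[r /= r0 rT].
have [N _ HN] := range_backward_comp_near xi r St r0.
exists N.+1 => // -[//|n] /= Nn.
suff : range (T i \o backward_comp T xi n) `<=` ball (T i a') d.
  by rewrite -backward_comp_cons.
by move=> _ [x _ <-]; apply: rT; apply: (HN n) => //; exists x.
Qed.

Lemma closure_target_set_invariant i : continuous (T i) ->
  T i @` closure (target_set T p) `<=` closure (target_set T p).
Proof.
move=> cT _ [x clx <-] U /(cT x)/clx[a [ta Ua]].
by exists (T i a); split => //; exact: target_set_invariant.
Qed.

Lemma iter_barnsley_hutchinson_sub C A n :
    (forall i, T i @` C `<=` C) -> A `<=` C ->
  iter n (barnsley_hutchinson T) A `<=` C.
Proof.
move=> TC AC; elim: n => //= n IH _ [i _ [x /IH Cx <-]].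
by apply: (TC i); exists x.
Qed.

(** [backward_comp] applies its newest map first, so the induction moves one
    application of the operator onto the starting set. *)
Lemma iter_barnsley_hutchinson_backward_comp A xi q n : A q ->
  iter n.+1 (barnsley_hutchinson T) A (backward_comp T xi n q).
Proof.
elim: n A q => [|n IH] A q Aq; first by exists (xi 0%N) => //; exists q.
rewrite iterSr /=; apply: IH; exists (xi n.+1) => //; by exists q.
Qed.

Lemma target_set_iter_near A a d : A !=set0 -> target_set T p a -> 0 < d ->
  \forall n \near \oo,
    exists2 z, iter n (barnsley_hutchinson T) A z & mdist a z < d.
Proof.
move=> [q Aq] [xi St <-] d0.
have /metricType_numDomainType.cvgrPdist_lt/(_ _ d0)[N _ HN] :=
  @coding_mapP R X k T p xi q cX St.
(* [backward_comp T xi n] is made of [n.+1] maps, hence the shifted rank. *)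
exists N.+1 => // -[//|n] /= Nn; exists (backward_comp T xi n q); last exact: HN.
exact: iter_barnsley_hutchinson_backward_comp.
Qed.

End Orbits.

Theorem corollary3p12 (R : realType) (X : metricType R) (p : X)
    (cX : compact [set: X]) (k : nat) (k_ge2 : (2 <= k)%N)
    (T : 'I_k -> X -> X) (cT : forall i, continuous (T i))
    (St_neq0 : weakly_hyperbolic T !=set0)
    (K : set X) (K_neq0 : K !=set0) (cK : compact K)
    (K_sub : K `<=` closure (target_set T p)) :
  hausdorff_dist (iter n (barnsley_hutchinson T) K) (closure (target_set T p))
    @[n --> \oo] --> (0 : R).
Proof.
have cC : compact (closure (target_set T p)).
  by apply: subclosed_compact cX _ => //; exact: closed_closure.
apply/cvgr0Pnorm_le => e e0.
have := compact_eventually_close _ (fun n => iter n (barnsley_hutchinson T) K)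
  e cC e0 (fun a ta d => target_set_iter_near T p cX K a d K_neq0 ta).
apply: filterS => n close; rewrite ger0_norm ?hausdorff_dist_ge0//.
apply: hausdorff_dist_sub_le (ltW e0) _ _.
  apply: iter_barnsley_hutchinson_sub => // i.
  exact: closure_target_set_invariant.
by move=> x /close[z Kz /ltW xz]; exists z.
Qed.
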